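(* Let $\mathcal{X}$ be a finite-dimensional real Hilbert space, $n\ge 1$, $L>0$, $\tau\in[0,L]$, and let $f_1,\dots,f_n:\mathcal{X}\to\mathbb{R}$ be $L$-smooth and $\tau$-weakly convex functions. Let $f=\frac1n\sum_{i=1}^n f_i$ and suppose that $f^\star=\inf f>-\infty$. Let $(x^t,g^t)_{t\ge0}$ be generated by the algorithm PAGE with probability $p\in(0,1]$, initial points $x^0,g^0\in\mathcal{X}$, and stepsize $\gamma>0$ satisfying $$\gamma\le\frac{1}{L\left(1+\sqrt{\frac{2\tau}{L+\tau}}\sqrt{\frac{1-p}{p}}\right)},$$ with the additional requirement $\gamma<\frac1L$ if $\tau=0$. Set $$a=\frac12,\qquad b=\frac{\gamma(L-\tau)}{4-2\gamma(L-\tau)},$$ $$\Psi^0=f(x^0)-f^\star-b\gamma\|\nabla f(x^0)\|^2+\frac{a\gamma}{p}\|g^0-\nabla f(x^0)\|^2+\frac{b\gamma}{p}\|g^0\|^2 .$$ For every $T\ge0$, let $\tilde{x}^T=x^t$, where $t$ is chosen uniformly at random in $\{0,\dots,T\}$ (independently of the algorithm). Then for every $T\ge 0$, $$\mathbb{E}\left[\|\nabla f(\tilde{x}^T)\|^2\right]\le\frac{1}{T+1}\,\frac{2\Psi^0}{\gamma-\gamma^2(L-\tau)} .$$ Moreover, $\|\nabla f(x^t)\|^2\to0$ almost surely as $t\to\infty$.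
   Context: A function $h:\mathcal{X}\to\mathbb{R}$ is $L$-smooth if it is differentiable on $\mathcal{X}$ and $\|\nabla h(x)-\nabla h(y)\|\le L\|x-y\|$ for all $x,y\in\mathcal{X}$. It is $\tau$-weakly convex if $h+\frac{\tau}{2}\|\cdot\|^2$ is convex. No minimizer of $f$ is assumed to exist. Algorithm PAGE. Inputs: (deterministic) $x^0,g^0\in\mathcal{X}$, stepsize $\gamma>0$, probability $p\in(0,1]$. For $t=0,1,2,\dots$: set $x^{t+1}=x^t-\gamma g^t$. Draw $\theta^t\in\{0,1\}$ with $\mathbb{P}(\theta^t=1)=p$, and $i^t$ uniformly at random in $\{1,\dots,n\}$. If $\theta^t=0$, set $g^{t+1}=g^t+\nabla f_{i^t}(x^{t+1})-\nabla f_{i^t}(x^t)$; if $\theta^t=1$, set $g^{t+1}=\nabla f(x^{t+1})$. All the random variables $\theta^0,i^0,\theta^1,i^1,\dots$ are mutually independent. *)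

(* Defs.v *)
From HB Require Import structures.
From mathcomp Require Import all_boot all_order all_algebra.
From mathcomp Require Import all_classical all_reals all_analysis.

Set Implicit Arguments.
Unset Strict Implicit.
Unset Printing Implicit Defensive.

Import Order.TTheory GRing.Theory Num.Theory.
Import numFieldNormedType.Exports.

Local Open Scope classical_set_scope.
Local Open Scope ring_scope.

(* Completeness is automatic: a [Vector] structure forces finite dimension. *)
HB.mixin Record NormedVector_isHilbert (R : realType) X
    of NormedModule R X & Vector R X := {
  inner : {dot X for idfun} ;
  inner_normE : forall u : X, (inner : X -> X -> R) u u = `|u| ^+ 2
}.

#[short(type="finHilbertType")]
HB.structure Definition FinHilbert (R : realType) :=
  {X of NormedModule R X & Vector R X & NormedVector_isHilbert R X}.

Section functions.
Context {R : realType} {X : finHilbertType R}.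
Implicit Types (h : X -> R) (x y : X) (L tau : R).

(* The Riesz representative of the differential; where [h] is differentiable
   it exists and is unique because [X] has finite dimension. *)
Definition grad h x : X :=
  xget 0 [set g : X | forall v, 'd h x v = (inner : {dot X for idfun}) g v].

Definition smooth L h :=
  (forall x, differentiable h x) /\
  (forall x y, `|grad h x - grad h y| <= L * `|x - y|).

Definition weakly_convex tau h :=
  convex_function [set: X] (fun x => h x + tau / 2 * `|x| ^+ 2).

Definition average n (f : 'I_n -> X -> R) x : R := n%:R^-1 * \sum_i f i x.

(* [page f gamma x0 g0 th ix t] is the pair (x^t, g^t) obtained when the
   coins are [th] and the drawn indices are [ix]. *)
Fixpoint page n (f : 'I_n -> X -> R) (gamma : R) (x0 g0 : X)
    (th : nat -> bool) (ix : nat -> 'I_n) (t : nat) : X * X :=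
  if t is s.+1 then
    let: (x, g) := page f gamma x0 g0 th ix s in
    let x' := x - gamma *: g in
    (x', if th s then grad (average f) x'
         else g + grad (f (ix s)) x' - grad (f (ix s)) x)
  else (x0, g0).

End functions.

Section discrete_ordinal.
Variable n : nat.

(* [measurableType] requires a point, hence ordinals of the form ['I_n.+1]. *)
HB.instance Definition _ := isPointed.Build 'I_n.+1 ord0.
HB.instance Definition _ := @isMeasurable.Build default_measure_display
  'I_n.+1 discrete_measurable discrete_measurable0
  discrete_measurableC discrete_measurableU.

End discrete_ordinal.

Section independence.
Context {d} {Omega : measurableType d} {R : realType}
  (P : probability Omega R).

Definition mutually_independent (I : eqType)
    (G : I -> set (set Omega)) : Prop :=
  forall (J : seq I) (A : I -> set Omega), uniq J ->
    (forall j, j \in J -> G j (A j)) ->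
    P (\bigcap_(j in [set` J]) A j) = (\prod_(j <- J) P (A j))%E.

Definition independent_systems (G H : set (set Omega)) : Prop :=
  forall A B, G A -> H B -> P (A `&` B) = (P A * P B)%E.

Definition uniform_ord n (X : {RV P >-> 'I_n.+1}) : Prop :=
  forall k, P (X @^-1` [set k]) = (n.+1%:R^-1)%:E.

Definition page_sigma n (th : nat -> {RV P >-> bool})
    (ix : nat -> {RV P >-> 'I_n.+1}) (k : nat + nat) : set (set Omega) :=
  match k with
  | inl t => g_sigma_algebra_preimage (th t)
  | inr t => g_sigma_algebra_preimage (ix t)
  end.

End independence.

(* Main.v *)
Require Import Defs.
From HB Require Import structures.
From mathcomp Require Import all_boot all_order all_algebra.
From mathcomp Require Import all_classical all_reals all_analysis.
From mathcomp Require Import measurable_realfun.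
From mathcomp Require Import ring lra.

Import Order.TTheory GRing.Theory Num.Theory.
Import numFieldNormedType.Exports.

Local Open Scope classical_set_scope.
Local Open Scope ring_scope.

(** Let [s = gamma (L - tau)], and let [Psi^t] be the expression [Psi^0] with
    [(x^0, g^0)] replaced by [(x^t, g^t)].  Each [f_i] satisfies the
    cocoercivity inequality
    [|D_i|^2 <= (L - tau) <D_i, d> + tau L |d|^2] for
    [D_i = grad f_i (x + d) - grad f_i x], by comparing the quadratic upper
    bound at one point with the quadratic lower bound at the other.  Averaged
    over [i] with [d = - gamma g^t], it bounds the variance created by a step of
    PAGE; together with the descent lemma for [f] it gives
    [E[Psi^(t+1) | past] <= Psi^t - gamma (1 - s) / 2 * |grad f x^t|^2], where
    [b] makes the terms in [<g, D>] cancel and the stepsize condition makes the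
    coefficient of [|g|^2] nonnegative.  Since [Psi^t >= 0], the numbers
    [E |grad f x^t|^2] have a finite sum, at most
    [2 Psi^0 / (gamma (1 - s))], which yields both claims.  The state
    [(x^t, g^t)] is a function of the first [t] draws, which take finitely many
    values, so all these expectations are finite weighted sums. *)

(** * Inner product, gradients, and inequalities for smooth weakly convex functions *)

Section Hilbert.
Context {R : realType} {X : finHilbertType R}.
Implicit Types (u v w x y : X) (h : X -> R).

Definition dotp u v : R := (inner : {dot X for idfun}) u v.

Lemma dotpC u v : dotp u v = dotp v u.
Proof. by rewrite /dotp hermC expr0 mul1r. Qed.

Lemma dotpDl u v w : dotp (u + v) w = dotp u w + dotp v w.
Proof. exact: linearDl. Qed.

Lemma dotpZl c u w : dotp (c *: u) w = c * dotp u w.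
Proof. exact: linearZl_LR. Qed.

Lemma dotpDr u v w : dotp w (u + v) = dotp w u + dotp w v.
Proof. by rewrite dotpC dotpDl !(dotpC w). Qed.

Lemma dotpZr c u w : dotp w (c *: u) = c * dotp w u.
Proof. by rewrite dotpC dotpZl (dotpC w). Qed.

Lemma dotpNl u w : dotp (- u) w = - dotp u w.
Proof. by rewrite -scaleN1r dotpZl mulN1r. Qed.

Lemma dotpNr u w : dotp w (- u) = - dotp w u.
Proof. by rewrite dotpC dotpNl (dotpC w). Qed.

Definition dotpE := (dotpDl, dotpDr, dotpNl, dotpNr, dotpZl, dotpZr).

Lemma dotp0l w : dotp 0 w = 0.
Proof. by rewrite -(scale0r 0) dotpZl mul0r. Qed.

Lemma dotp_suml I (r : seq I) (F : I -> X) w :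
  dotp (\sum_(i <- r) F i) w = \sum_(i <- r) dotp (F i) w.
Proof.
by apply: (big_morph (dotp^~ w)) => [u v|]; rewrite ?dotpDl ?dotp0l.
Qed.

Lemma dotp_sumr I (r : seq I) (F : I -> X) w :
  dotp w (\sum_(i <- r) F i) = \sum_(i <- r) dotp w (F i).
Proof. by rewrite dotpC dotp_suml; apply: eq_bigr => i _; rewrite dotpC. Qed.

Lemma sqr_normE u : `|u| ^+ 2 = dotp u u.
Proof. by rewrite -inner_normE. Qed.

Lemma dotp_eq0 u : dotp u u = 0 -> u = 0.
Proof. by move/eqP; rewrite -sqr_normE expf_eq0 normr_eq0 => /eqP. Qed.

(* The linear map [g |-> sum_i <g, e_i> e_i] attached to a basis [e] is
   injective by definiteness, hence onto by finiteness of the dimension. *)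
Lemma riesz (phi : {linear X -> R}) : exists g, forall v, phi v = dotp g v.
Proof.
pose e := vbasis {:X}.
have eb : basis_of {:X} e by exact: vbasisP.
pose F (g : X) : X := \sum_(i < \dim {:X}) dotp g e`_i *: e`_i.
have Flin : linear F.
  move=> a u v; rewrite /F scaler_sumr -big_split; apply: eq_bigr => i _ /=.
  by rewrite dotpDl dotpZl scalerDl scalerA.
pose Fl := GRing.isLinear.Build _ _ _ _ F Flin.
pose FL : {linear X -> X} := HB.pack F Fl.
pose f := linfun FL.
have fE g : f g = F g by rewrite lfunE.
have eE v : v = \sum_(i < \dim {:X}) coord e i v *: e`_i.
  by apply: (coord_basis eb); exact: memvf.
have kerf : lker f == 0%VS.
  rewrite -subv0; apply/subvP => g; rewrite memv_ker fE => /eqP Fg0.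
  have ge0 := freeP (basis_free eb) _ Fg0.
  rewrite memv0; apply/eqP/dotp_eq0.
  by rewrite {2}(eE g) dotp_sumr big1// => i _; rewrite dotpZr ge0 mulr0.
pose y := \sum_(i < \dim {:X}) phi e`_i *: e`_i.
exists (f^-1%VF y) => v; set g := f^-1%VF y.
have gy : F g = y by rewrite -fE lker0_lfunVK.
have phie (i : 'I_(\dim {:X})) : phi e`_i = dotp g e`_i.
  have /(freeP (basis_free eb)) :
      \sum_(i < \dim {:X}) (phi e`_i - dotp g e`_i) *: e`_i = 0.
    under eq_bigr do rewrite scalerBl.
    by rewrite sumrB -/y -/(F g) gy subrr.
  by move/(_ i)/eqP; rewrite subr_eq0 => /eqP.
rewrite (eE v) dotp_sumr linear_sum; apply: eq_bigr => i _ /=.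
by rewrite linearZ dotpZr phie.
Qed.

(** Riesz representation supplies a witness, so [xget] returns a true representative and not its
    default [0]. *)
Lemma gradE h x v : 'd h x v = dotp (grad h x) v.
Proof.
have [g gP] := riesz ('d h x).
exact: (xgetPex 0 (ex_intro [set g | forall v, 'd h x v = dotp g v] g gP)).
Qed.

Lemma grad_unique h x g : (forall v, 'd h x v = dotp g v) -> grad h x = g.
Proof.
move=> gP.
have g'P v : 'd h x v = dotp (grad h x) v.
  exact: (xgetPex 0 (ex_intro [set g | forall v, 'd h x v = dotp g v] g gP)).
apply/eqP; rewrite -subr_eq0; apply/eqP/dotp_eq0.
by rewrite dotpDl dotpNl -g'P -gP subrr.
Qed.

Lemma is_derive_line h x v (t : R) : differentiable h (x + t *: v) ->
  is_derive t 1 (fun s : R => h (x + s *: v)) (dotp (grad h (x + t *: v)) v).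
Proof.
move=> hd.
set l := fun s : R => x + s *: v.
have dl : is_diff t l ( *:%R^~ v).
  rewrite -[*:%R^~ v]add0r.
  exact: (is_diffD (is_diff_cst x t) (is_diff_scalel t v)).
have dlt : differentiable l t by apply: ex_diff.
have dhl : differentiable (h \o l) t by exact: differentiable_comp.
apply: DeriveDef; first exact: diff_derivable.
by rewrite deriveE// diff_comp//= diff_val /= scale1r gradE.
Qed.

(** Cauchy-Schwarz: the squared norm of [|v| u - |u| v] is [2 |u| |v| (|u| |v| - <u, v>)]. *)
Lemma dotp_le_norm u v : dotp u v <= `|u| * `|v|.
Proof.
have [->|u0] := eqVneq u 0; first by rewrite dotp0l mulr_ge0.
have [->|v0] := eqVneq v 0; first by rewrite dotpC dotp0l mulr_ge0.
have uv0 : 0 < 2 * (`|u| * `|v|) by rewrite !mulr_gt0// normr_gt0.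
rewrite -(ler_pM2l uv0) -subr_ge0.
rewrite (_ : _ - _ = `| `|v| *: u - `|u| *: v | ^+ 2) ?sqr_ge0//.
by rewrite sqr_normE !dotpE -!sqr_normE (dotpC v u); ring.
Qed.

(* Mean value theorem for [s |-> h (x + s v) - k s^2]. *)
Lemma mvt_line h x v (k : R) : (forall x, differentiable h x) ->
  exists2 c : R, 0 <= c <= 1 &
    h (x + v) - h x - k = dotp (grad h (x + c *: v)) v - 2 * k * c.
Proof.
move=> hd.
pose phi (s : R) : R := h (x + s *: v) - k * s ^+ 2.
have dphi (s : R) :
    is_derive s 1 phi (dotp (grad h (x + s *: v)) v - 2 * k * s).
  have hl := is_derive_line h x v s (hd _).
  rewrite (_ : phi = (fun s => h (x + s *: v)) - (fun s => k * s ^+ 2))//.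
  apply: is_derive_eq; rewrite /GRing.scale /=; ring.
have cphi : {within `[0, 1], continuous phi}.
  apply: continuous_subspaceT => s.
  by apply/differentiable_continuous/derivable1_diffP/ex_derive.
have [c c01 E] := MVT_segment ler01 (fun s _ => dphi s) cphi.
exists c; first by rewrite in_itv in c01.
by move: E; rewrite /phi scale1r scale0r addr0; lra.
Qed.

(** The descent lemma without integration. With [k = L / 2 * |v|^2] in [mvt_line], the correction
    [2 k c] is exactly the Lipschitz bound on [<grad h (x + c v) - grad h x, v>], whence the sharp
    constant [L / 2]. *)
Lemma smooth_le (L : R) h x y : smooth L h ->
  h y <= h x + dotp (grad h x) (y - x) + L / 2 * `|y - x| ^+ 2.
Proof.
move=> [hd hL]; set v := y - x.
have -> : y = x + v by rewrite /v addrC subrK.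
clearbody v.
have alg (c a b D D0 N : R) : a - b - L / 2 * N ^+ 2 =
    D - 2 * (L / 2 * N ^+ 2) * c -> D - D0 <= L * (c * N) * N ->
    a <= b + D0 + L / 2 * N ^+ 2.
  by move=> *; lra.
have [c /andP[c0 c1] E] := mvt_line h x v (L / 2 * `|v| ^+ 2) hd.
apply: alg E _; rewrite -dotpNl -dotpDl.
apply: (le_trans (dotp_le_norm _ _)).
apply: ler_wpM2r => //; apply: (le_trans (hL _ _)).
by rewrite addrAC subrr add0r normrZ (ger0_norm c0).
Qed.

(** The cruder constant [L], from [k = 0], suffices: in [weakly_convex_ge] the quadratic term
    disappears in the limit of small steps. *)
Lemma smooth_ge (L : R) h x v : 0 <= L -> smooth L h ->
  h x + dotp (grad h x) v - L * `|v| ^+ 2 <= h (x + v).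
Proof.
move=> L0 [hd hL].
have alg (c a b D D0 N : R) : a - b - 0 = D - 2 * 0 * c ->
    D0 - D <= L * N * N -> b + D0 - L * N ^+ 2 <= a.
  by move=> *; lra.
have [c /andP[c0 c1] E] := mvt_line h x v 0 hd.
apply: alg E _; rewrite -dotpNl -dotpDl.
apply: (le_trans (dotp_le_norm _ _)).
apply: ler_wpM2r => //; apply: (le_trans (hL _ _)); apply: ler_wpM2l => //.
by rewrite opprD addrA subrr sub0r normrN normrZ (ger0_norm c0) ler_piMl.
Qed.

(** Convexity between [x + v] and [x]; the quadratic terms combine through [s |x + v|^2 + (1 - s)
    |x|^2 - |x + s v|^2 = s (1 - s) |v|^2]. *)
Lemma weakly_convex_line (tau s : R) h x v : weakly_convex tau h ->
  0 <= s <= 1 ->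
  h (x + s *: v) <= s * h (x + v) + (1 - s) * h x
    + tau / 2 * (s * (1 - s)) * `|v| ^+ 2.
Proof.
move=> hw /andP[s0 s1].
have : h (s *: (x + v) + (1 - s) *: x) +
    tau / 2 * `|s *: (x + v) + (1 - s) *: x| ^+ 2 <=
    s * (h (x + v) + tau / 2 * `|x + v| ^+ 2) +
    (1 - s) * (h x + tau / 2 * `|x| ^+ 2).
  exact: (hw (Itv01 s0 s1) (x + v) x (in_setT _) (in_setT _)).
have -> : s *: (x + v) + (1 - s) *: x = x + s *: v.
  by rewrite scalerDr addrAC -scalerDl addrC subrKC scale1r addrC.
rewrite !sqr_normE !dotpE (dotpC v x); lra.
Qed.

(** Comparing [weakly_convex_line] with [smooth_ge] at [x + s v], dividing by [s] and letting [s]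
    tend to 0 gives the tangent bound. *)
Lemma weakly_convex_ge (L tau : R) h x y : 0 <= L -> 0 <= tau ->
  smooth L h -> weakly_convex tau h ->
  h x + dotp (grad h x) (y - x) - tau / 2 * `|y - x| ^+ 2 <= h y.
Proof.
move=> L0 tau0 hs hw; set v := y - x.
have yE : y = x + v by rewrite /v addrC subrK.
clearbody v.
have slope (s : R) : 0 < s <= 1 ->
    dotp (grad h x) v - s * (L * `|v| ^+ 2) <= h y - h x + tau / 2 * `|v| ^+ 2.
  move=> /andP[s0 s1]; rewrite -(ler_pM2l s0).
  have s01 : 0 <= s <= 1 by rewrite ltW.
  have := weakly_convex_line tau s h x v hw s01.
  have := smooth_ge L h x (s *: v) L0 hs.
  have : 0 <= tau / 2 * s ^+ 2 * `|v| ^+ 2.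
    by apply: mulr_ge0 (sqr_ge0 _); apply: mulr_ge0 (sqr_ge0 _); rewrite divr_ge0.
  by rewrite yE dotpZr normrZ (gtr0_norm s0); lra.
pose K := L * `|v| ^+ 2.
have K0 : 0 <= K by rewrite mulr_ge0.
suff : dotp (grad h x) v <= h y - h x + tau / 2 * `|v| ^+ 2 by lra.
apply/ler_addgt0Pr => e e0.
(* This [s] satisfies [s K <= e]; having [e] in the denominator covers [K = 0]. *)
have s01 : 0 < e / (e + K) <= 1.
  by rewrite divr_gt0 ?ltr_wpDr//= ler_pdivrMr ?ltr_wpDr// mul1r lerDl.
have := slope _ s01; rewrite -/K.
suff : e / (e + K) * K <= e by lra.
by rewrite mulrAC ler_pdivrMr ?ltr_wpDr// ler_pM2l// lerDr ltW.
Qed.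

(** Interpolates between the Baillon-Haddad inequality ([tau = 0]) and the plain Lipschitz bound
    ([tau = L]). *)
Lemma cocoercive (L tau : R) h x y : 0 < L -> 0 <= tau ->
  smooth L h -> weakly_convex tau h ->
  `|grad h y - grad h x| ^+ 2 <=
    (L - tau) * dotp (grad h y - grad h x) (y - x) + tau * L * `|y - x| ^+ 2.
Proof.
move=> L0 tau0 hs hw; have L0' := ltW L0.
have [M ME] : exists M, M = L + tau by exists (L + tau).
have M0 : 0 < M by rewrite ME ltr_wpDr.
(* The lower bound at [x'] and the upper bound at [y'] are compared at [y' + w]. The gain is
   [<r, w> - M / 2 * |w|^2] with [r = grad h x' - grad h y' + tau (x' - y')]; it is largest at
   [w = r / M], where it equals [|r|^2 / (2 M)]. *)
have key x' y' :
    h x' + dotp (grad h x') (y' - x') - tau / 2 * `|y' - x'| ^+ 2 +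
      (2 * M)^-1 * `|grad h x' - grad h y' + tau *: (x' - y')| ^+ 2 <= h y'.
  have wE (r : X) : M / 2 * `|M^-1 *: r| ^+ 2 = (2 * M)^-1 * `|r| ^+ 2.
    by rewrite !sqr_normE dotpZl dotpZr; field; rewrite gt_eqF.
  have rwE (r : X) : dotp r (M^-1 *: r) = 2 * ((2 * M)^-1 * `|r| ^+ 2).
    by rewrite !sqr_normE dotpZr; field; rewrite gt_eqF.
  move: (wE (grad h x' - grad h y' + tau *: (x' - y')))
    (rwE (grad h x' - grad h y' + tau *: (x' - y'))).
  set w := M^-1 *: _; move: w ((2 * M)^-1 * _) => {wE rwE} w q.
  have := weakly_convex_ge L tau h x' (y' + w) L0' tau0 hs hw.
  have := smooth_le L h y' (y' + w) hs.
  rewrite (addrC y' w) addrK -addrA ME.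
  move: (grad h x') (grad h y') (h (w + y')) (h x') (h y') => G' G H H' H''.
  rewrite !sqr_normE !dotpE (dotpC y' w) (dotpC x' w) (dotpC x' y').
by move=> *; lra.
(* Adding the two instances eliminates the values of [h]; expanding the square then gives the
   claim. *)
move: {key} (key x y) (key y x).
move: (grad h x) (grad h y) (h x) (h y) => g g' hx hy.
have -> : x - y = - (y - x) by rewrite opprB.
have -> : g - g' = - (g' - g) by rewrite opprB.
have : dotp (g' - g) (y - x) = dotp g' (y - x) - dotp g (y - x).
  by rewrite dotpDl dotpNl.
move: (y - x) (g' - g) => v G GE.
rewrite scalerN -opprD !normrN => {}hs {}hw.
have {hs hw} : M^-1 * `|G + tau *: v| ^+ 2 <= dotp G v + tau * `|v| ^+ 2.
  move: hs hw; rewrite invfM -(mulrA 2^-1) !dotpNr.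
  by move: (M^-1 * _) => q *; lra.
by rewrite ler_pdivrMl// !sqr_normE !dotpE (dotpC v G) ME => H; lra.
Qed.

End Hilbert.

(** * Averages over the component functions *)

Section Average.
Context {R : realType} {X : finHilbertType R} {n : nat}.
Variables (f_ : 'I_n.+1 -> X -> R).
Implicit Types (D : 'I_n.+1 -> X) (c x y u : X).

Lemma averageE : average f_ = n.+1%:R^-1 *: \sum_i f_ i.
Proof.
apply/funext => x; rewrite /average.
by rewrite fct_sumE.
Qed.

Lemma differentiable_average x : (forall i, differentiable (f_ i) x) ->
  differentiable (average f_) x.
Proof.
by move=> fd; rewrite averageE; apply/differentiableZ/differentiable_sum.
Qed.

Lemma grad_average x : (forall i, differentiable (f_ i) x) ->
  grad (average f_) x = n.+1%:R^-1 *: \sum_i grad (f_ i) x.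
Proof.
move=> fd; apply: grad_unique => v.
have dsum : differentiable (\sum_i f_ i) x by exact: differentiable_sum.
rewrite averageE diffZ//= dotpZl dotp_suml -deriveE//; congr (_ * _).
rewrite derive_sum => [|i]; last exact: diff_derivable.
by apply: eq_bigr => i _; rewrite deriveE// gradE.
Qed.

Lemma average_smooth (L : R) : (forall i, smooth L (f_ i)) ->
  smooth L (average f_).
Proof.
move=> fs; split=> [x|x y].
  by apply: differentiable_average => i; exact: (fs i).1.
rewrite !grad_average => [||i]; [|by move=> i; exact: (fs i).1|exact: (fs i).1].
rewrite -scalerBr -sumrB normrZ ger0_norm ?invr_ge0// ler_pdivrMl ?ltr0n//.
apply: le_trans (ler_norm_sum _ _ _) _.
apply: le_trans (ler_sum _ (fun i _ => (fs i).2 x y)) _.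
by rewrite sumr_const card_ord mulr_natl.
Qed.

Lemma mean_sqr_norm D c : n.+1%:R^-1 * \sum_i `|c + D i| ^+ 2 =
  `|c| ^+ 2 + 2 * dotp c (n.+1%:R^-1 *: \sum_i D i)
    + n.+1%:R^-1 * \sum_i `|D i| ^+ 2.
Proof.
have -> : \sum_i `|c + D i| ^+ 2 =
    n.+1%:R * `|c| ^+ 2 + 2 * dotp c (\sum_i D i) + \sum_i `|D i| ^+ 2.
  have -> : n.+1%:R * `|c| ^+ 2 = \sum_(i < n.+1) `|c| ^+ 2.
    by rewrite sumr_const card_ord mulr_natl.
  rewrite dotp_sumr mulr_sumr.
  rewrite -!big_split; apply: eq_bigr => i _ /=.
  by rewrite !sqr_normE !dotpE (dotpC (D i) c); ring.
by rewrite dotpZr !mulrDr mulKf ?pnatr_eq0// [2 * (_ * _)]mulrCA.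
Qed.

Lemma le_mean (F G : 'I_n.+1 -> R) : (forall i, F i <= G i) ->
  n.+1%:R^-1 * \sum_i F i <= n.+1%:R^-1 * \sum_i G i.
Proof.
by move=> FG; rewrite ler_wpM2l ?invr_ge0//; exact: ler_sum.
Qed.

Lemma mean_cst (c : R) : n.+1%:R^-1 * \sum_(i < n.+1) c = c.
Proof.
by rewrite sumr_const card_ord -[c *+ _]mulr_natl mulKf ?pnatr_eq0.
Qed.

Lemma mean_affine (c a b : R) (F G : 'I_n.+1 -> R) :
  n.+1%:R^-1 * \sum_i (c + a * F i + b * G i) =
    c + a * (n.+1%:R^-1 * \sum_i F i) + b * (n.+1%:R^-1 * \sum_i G i).
Proof.
by rewrite !big_split/= -!mulr_sumr !mulrDr mean_cst !(mulrCA n.+1%:R^-1).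
Qed.

(** The displacement is common to all [i] and the inner product is linear in the gradient variation,
    so averaging only turns it into that of the average. *)
Lemma mean_cocoercive (L tau : R) x y : 0 < L -> 0 <= tau ->
  (forall i, smooth L (f_ i)) -> (forall i, weakly_convex tau (f_ i)) ->
  n.+1%:R^-1 * \sum_i `|grad (f_ i) y - grad (f_ i) x| ^+ 2 <=
    (L - tau) * dotp (grad (average f_) y - grad (average f_) x) (y - x)
      + tau * L * `|y - x| ^+ 2.
Proof.
move=> L0 tau0 fs fw.
apply: le_trans (le_mean _ _ (fun i => cocoercive L tau _ x y L0 tau0 (fs i) (fw i))) _.
rewrite !grad_average => [||i]; [|by move=> i; exact: (fs i).1|exact: (fs i).1].
rewrite -scalerBr -sumrB dotpZl dotp_suml big_split/= mulrDr mean_cst.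
by rewrite -mulr_sumr mulrCA.
Qed.

End Average.

(** A gradient step of length [1 / L] decreases [h] by at least the left side, and cannot go below
    the infimum. *)
Lemma smooth_grad_le {R : realType} {X : finHilbertType R} (L : R)
    (h : X -> R) (x : X) : 0 < L -> smooth L h -> has_lbound (range h) ->
  (2 * L)^-1 * `|grad h x| ^+ 2 <= h x - inf (range h).
Proof.
move=> L0 hs hlb.
have := smooth_le L h x (x - L^-1 *: grad h x) hs.
have : inf (range h) <= h (x - L^-1 *: grad h x).
  by apply: ge_inf => //; exists (x - L^-1 *: grad h x).
move: (grad h x) (inf _) => G I.
have -> : x - L^-1 *: G - x = - (L^-1 *: G) by rewrite addrAC subrr add0r.
move: (h x) (h _) => hx H; rewrite normrN !sqr_normE !dotpE.
have -> : (2 * L)^-1 = L^-1 / 2 by rewrite invfM mulrC.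
have -> : L / 2 * (L^-1 * (L^-1 * dotp G G)) = L^-1 / 2 * dotp G G.
  by field; rewrite gt_eqF.
by move=> *; lra.
Qed.

(** * Consequences of the stepsize condition *)

Section Stepsize.
Context {R : realType} (L tau p gamma : R).
Hypotheses (L_gt0 : 0 < L) (tau_itv : 0 <= tau <= L)
  (p_itv : 0 < p <= 1) (gamma_gt0 : 0 < gamma)
  (gamma_le : gamma <=
     1 / (L * (1 + Num.sqrt (2 * tau / (L + tau)) * Num.sqrt ((1 - p) / p)))).

Lemma stepsize_le1 : gamma * L <= 1.
Proof.
have r0 := mulr_ge0 (sqrtr_ge0 (2 * tau / (L + tau))) (sqrtr_ge0 ((1 - p) / p)).
rewrite -ler_pdivlMr//; apply: (le_trans gamma_le).
by rewrite !mul1r lef_pV2 ?posrE ?mulr_gt0 ?ltr_wpDr// ler_pMr// lerDl.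
Qed.

(** For [tau > 0] strictness comes from [gamma * tau > 0]; for [tau = 0] it is the additional
    requirement on [gamma]. *)
Lemma stepsize_contract : (tau = 0 -> gamma < 1 / L) ->
  gamma * (L - tau) < 1.
Proof.
move=> gamma_lt; have [t0 tL] := andP tau_itv.
have := stepsize_le1; have [tau0|] := eqVneq tau 0.
  by have := gamma_lt tau0; rewrite ltr_pdivlMr// tau0 subr0.
rewrite neq_lt ltNge t0/= => tau0; have := mulr_gt0 gamma_gt0 tau0; lra.
Qed.

(** The form in which [lyapunov_alg] uses the stepsize, to control [|g|^2]. With [G = gamma L] the
    condition reads [G r <= 1 - G]; squaring it gives [Grr]. *)
Lemma stepsize_bound :
  L * gamma * (2 - gamma * (L - tau)) <=
    2 * (1 - (1 - p) / p * gamma ^+ 2 * (tau * L)).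
Proof.
have [t0 tL] := andP tau_itv; have [p0 p1] := andP p_itv.
have Lt0 : 0 < L + tau by rewrite ltr_wpDr.
set r := Num.sqrt (2 * tau / (L + tau)) * Num.sqrt ((1 - p) / p).
set q := (1 - p) / p.
have q0 : 0 <= q by rewrite divr_ge0 ?subr_ge0// ltW.
have r0 : 0 <= r by rewrite mulr_ge0 ?sqrtr_ge0.
have rE : r ^+ 2 * (L + tau) = 2 * tau * q.
  rewrite exprMn !sqr_sqrtr ?divr_ge0 ?mulr_ge0 ?subr_ge0// 1?ltW//.
  by rewrite -/q; field; rewrite gt_eqF.
set G := gamma * L.
have Gr : G * (1 + r) <= 1.
  rewrite /G -mulrA -ler_pdivlMr; first exact: gamma_le.
  by rewrite mulr_gt0// ltr_wpDr.
have G0 : 0 <= G by rewrite ltW ?mulr_gt0.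
have G1 : G <= 1 by exact: stepsize_le1.
have Grr : 2 * G ^+ 2 * tau * q <= (1 - G) ^+ 2 * (L + tau).
  have -> : 2 * G ^+ 2 * tau * q = (G * r) ^+ 2 * (L + tau).
    by transitivity (G ^+ 2 * (r ^+ 2 * (L + tau))); [rewrite rE|]; ring.
  apply: ler_wpM2r; first exact: ltW.
  apply: lerXn2r; rewrite ?nnegrE ?subr_ge0//; first exact: mulr_ge0.
  by move: Gr; lra.
rewrite -(ler_pM2r L_gt0).
have -> : L * gamma * (2 - gamma * (L - tau)) * L =
    G * (2 * L) - G ^+ 2 * (L - tau) by rewrite /G; ring.
have -> : 2 * (1 - q * gamma ^+ 2 * (tau * L)) * L =
    2 * L - 2 * G ^+ 2 * tau * q by rewrite /G; ring.
(* This product is [2 L (1 - G) - (1 - G)^2 (L + tau)], the slack left after inserting [Grr], up to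
   [G^2 (L - tau)]. *)
have : 0 <= (1 - G) * (L - tau + G * (L + tau)).
  by apply: mulr_ge0; [|apply: addr_ge0; [|apply: mulr_ge0 => //; exact: ltW]];
    rewrite subr_ge0.
have : 0 <= G ^+ 2 * (L - tau) by apply: mulr_ge0; rewrite ?sqr_ge0 ?subr_ge0.
move: Grr; lra.
Qed.

End Stepsize.

(** * The Lyapunov function and its expected decrease in one step *)

Section Lyapunov.
Context {R : realType} {X : finHilbertType R}.

(** The pair [z] is [(x^t, g^t)], and [a] has its value [1 / 2]. In expectation over a step, the
    negative gradient term cancels the last term of the refresh branch, which has probability
    [p]. *)
Definition lyapunov (f : X -> R) (p gamma b : R) (z : X * X) : R :=
  f z.1 - inf (range f) - b * gamma * `|grad f z.1| ^+ 2
  + 1 / 2 * gamma / p * `|z.2 - grad f z.1| ^+ 2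
  + b * gamma / p * `|z.2| ^+ 2.

Context {n : nat} (L tau : R) (f_ : 'I_n.+1 -> X -> R).
Hypotheses (L_gt0 : 0 < L) (tau_itv : 0 <= tau <= L)
  (f_smooth : forall i, smooth L (f_ i))
  (f_wconv : forall i, weakly_convex tau (f_ i))
  (f_lb : has_lbound (range (average f_))).
Context (p gamma : R).
Hypotheses (p_itv : 0 < p <= 1) (gamma_gt0 : 0 < gamma)
  (gammaL : gamma * L <= 1)
  (contract : gamma * (L - tau) < 1)
  (step : L * gamma * (2 - gamma * (L - tau)) <=
    2 * (1 - (1 - p) / p * gamma ^+ 2 * (tau * L))).

Let f := average f_.
Let s := gamma * (L - tau).
Let b := s / (4 - 2 * s).

Let s_ge0 : 0 <= s.
Proof.
case/andP: tau_itv => _ tL.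
by apply: mulr_ge0; [exact: ltW|rewrite subr_ge0].
Qed.

Let den_gt0 : 0 < 4 - 2 * s.
Proof. by have := contract; rewrite -/s => *; lra. Qed.

Let bE : b * (4 - 2 * s) = s.
Proof. by rewrite /b divfK// gt_eqF. Qed.

Let b_ge0 : 0 <= b.
Proof. by rewrite /b divr_ge0// ltW. Qed.

Let b_le : 2 * b <= s.
Proof.
rewrite /b mulrA ler_pdivrMr//.
have s1 : 0 <= 1 - s by rewrite subr_ge0 ltW.
by have := mulr_ge0 s_ge0 s1; lra.
Qed.

(** Since [2 b gamma L <= 1], [smooth_grad_le] lets [f - inf f] absorb the only negative gradient
    term. *)
Lemma lyapunov_ge0 z : 0 <= lyapunov f p gamma b z.
Proof.
have [p0 p1] := andP p_itv.
have g0 := ltW gamma_gt0; have ip0 : 0 <= p^-1 by rewrite invr_ge0 ltW.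
rewrite /lyapunov; apply: addr_ge0; [apply: addr_ge0|]; last 2 first.
- by apply: mulr_ge0 (sqr_ge0 _); do 2!apply: mulr_ge0 => //; rewrite divr_ge0.
- by apply: mulr_ge0 (sqr_ge0 _); do 2!apply: mulr_ge0 => //.
rewrite subr_ge0.
have fs : smooth L f by exact: average_smooth.
apply: le_trans (smooth_grad_le L f z.1 L_gt0 fs f_lb).
rewrite ler_wpM2r ?sqr_ge0// -[leRHS]mul1r ler_pdivlMr ?mulr_gt0//.
have b1 : 2 * b <= 1 by apply: (le_trans b_le); exact: ltW.
have : 2 * b * (gamma * L) <= 1 
  by apply: mulr_ile1 => //; apply: mulr_ge0 => //; exact: ltW.
by lra.
Qed.

(* [u] is the inner product of [g] with the gradient variation [D], [w] that of
   [g] with [grad f x], and [q] is [(1 - p) / p].  The terms in [u] cancel: this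
   is what determines [b]. *)
Lemma lyapunov_alg (b' s' q F F' fs G2 G2' g2 e2 V u D2 w : R) :
  0 <= q -> b' * (4 - 2 * s') = s' -> 2 * b' <= s' -> s' < 1 ->
  L * gamma * (2 - s') <= 2 * (1 - q * gamma ^+ 2 * (tau * L)) ->
  0 <= g2 -> 0 <= G2 -> 0 <= D2 ->
  e2 = g2 - 2 * w + G2 ->
  F' <= F - gamma * w + L / 2 * gamma ^+ 2 * g2 ->
  V <= - s' * u + tau * L * gamma ^+ 2 * g2 ->
  F' - fs + gamma / 2 * q * (e2 - D2 + V) + b' * gamma * q * (g2 + 2 * u + V)
  <= F - fs - b' * gamma * G2 + gamma / 2 * (1 + q) * e2
     + b' * gamma * (1 + q) * g2 - gamma * (1 - s') / 2 * G2.
Proof.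
move=> q0 bE' bs s1 st g0 G0 D0 eE FF VV.
(* [gamma * q * k] is the total coefficient of [V]. The relation [k s' = 2 b'] cancels the terms in
   [u], and [k (2 - s') = 1] turns the stepsize condition into a bound on [L gamma^2 g2]. *)
pose k := 1 / 2 + b'.
have kE : k * (2 - s') = 1 by rewrite /k; lra.
have k0 : 0 < k.
  have : 0 < k * (2 - s') by rewrite kE.
  by rewrite pmulr_lgt0//; lra.
have ks : k * s' = 2 * b' by rewrite /k; lra.
have h1 : q * gamma * k * V <=
    q * gamma * k * (- s' * u + tau * L * gamma ^+ 2 * g2).
  by rewrite ler_wpM2l// !mulr_ge0// ltW.
have h2 : gamma * g2 * k * (L * gamma * (2 - s')) <=
    gamma * g2 * k * (2 * (1 - q * gamma ^+ 2 * (tau * L))).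
  by rewrite ler_wpM2l// !mulr_ge0// ltW.
have h2' : gamma * g2 * k * (L * gamma * (2 - s')) = L * gamma ^+ 2 * g2.
  by transitivity (L * gamma ^+ 2 * g2 * (k * (2 - s'))); [ring|rewrite kE mulr1].
have h1' : q * gamma * k * (- s' * u + tau * L * gamma ^+ 2 * g2) =
    - (q * gamma * u * (2 * b')) + q * gamma ^+ 3 * k * tau * L * g2.
  by rewrite -ks; ring.
have h3 : 0 <= q * gamma * D2 by rewrite !mulr_ge0// ltW.
(* Half of this is what remains of the terms in [G2]. *)
have h4 : 0 <= gamma * G2 * (s' - 2 * b').
  by rewrite mulr_ge0 ?subr_ge0// mulr_ge0// ltW.
have h5 : q * gamma * k * V = q * gamma * V / 2 + q * gamma * V * b'.
  by rewrite /k; ring.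
have h6 : gamma * g2 * k * (2 * (1 - q * gamma ^+ 2 * (tau * L))) =
  gamma * g2 + 2 * gamma * g2 * b' - 2 * (q * gamma ^+ 3 * k * tau * L * g2).
  by rewrite /k; field.
rewrite h2' h6 in h2; rewrite h5 h1' in h1.
move: (q * gamma ^+ 3 * k * tau * L * g2) h1 h2 => W h1 h2.
by rewrite eE; lra.
Qed.

(** The step with the points abstracted away: [F], [F'] are values of [f], [G], [G'] its gradients,
    [D i] the variation of the [i]-th gradient. It reduces to [lyapunov_alg] with [q = (1 - p) / p],
    for which [1 / p = 1 + q]. *)
Lemma lyapunov_step_vec (F F' fs : R) (g G G' : X) (D : 'I_n.+1 -> X)
    (V := n.+1%:R^-1 * \sum_i `|D i| ^+ 2) :
  G' - G = n.+1%:R^-1 *: \sum_i D i ->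
  F' <= F - gamma * dotp G g + L / 2 * gamma ^+ 2 * `|g| ^+ 2 ->
  V <= - s * dotp g (G' - G) + tau * L * gamma ^+ 2 * `|g| ^+ 2 ->
  p * (F' - fs - b * gamma * `|G'| ^+ 2 + 1 / 2 * gamma / p * `|G' - G'| ^+ 2
       + b * gamma / p * `|G'| ^+ 2)
  + (1 - p) * (n.+1%:R^-1 * \sum_i
      (F' - fs - b * gamma * `|G'| ^+ 2
       + 1 / 2 * gamma / p * `|g + D i - G'| ^+ 2
       + b * gamma / p * `|g + D i| ^+ 2))
  <= F - fs - b * gamma * `|G| ^+ 2 + 1 / 2 * gamma / p * `|g - G| ^+ 2
     + b * gamma / p * `|g| ^+ 2 - gamma * (1 - s) / 2 * `|G| ^+ 2.
Proof.
move=> DE FF VV; have [p0 p1] := andP p_itv.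
have m1 : n.+1%:R^-1 * \sum_i `|g + D i| ^+ 2 =
    `|g| ^+ 2 + 2 * dotp g (G' - G) + V by rewrite mean_sqr_norm DE.
(* Bias and variance: [g + D i - G'] has mean [g - G] and variance [V - |G' - G|^2]. *)
have m2 : n.+1%:R^-1 * \sum_i `|g + D i - G'| ^+ 2 =
    `|g - G| ^+ 2 - `|G' - G| ^+ 2 + V.
  under eq_bigr do rewrite addrAC.
  rewrite mean_sqr_norm -/V -DE; move: (V) => v.
  by rewrite !sqr_normE !dotpE (dotpC G G') (dotpC G g) (dotpC G' g); ring.
have q0 : 0 <= (1 - p) / p by rewrite divr_ge0 ?subr_ge0// ltW.
have eE : `|g - G| ^+ 2 = `|g| ^+ 2 - 2 * dotp G g + `|G| ^+ 2.
  by rewrite !sqr_normE !dotpE (dotpC g); ring.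
have := lyapunov_alg b s ((1 - p) / p) F F' fs _ 0 _ _ V _ _ _
  q0 bE b_le contract step (sqr_ge0 `|g|) (sqr_ge0 `|G|)
  (sqr_ge0 `|G' - G|) eE FF VV.
rewrite mean_affine m1 m2 subrr normr0 expr0n/= mulr0 addr0.
move=> /le_trans; have p_neq0 : p != 0 by rewrite gt_eqF.
set rhs := (X in _ <= X); set lhs := (X in X <= _).
suff [-> rhsE] : lhs = F' - fs + gamma / 2 * ((1 - p) / p) *
    (`|g - G| ^+ 2 - `|G' - G| ^+ 2 + V) + b * gamma * ((1 - p) / p) *
    (`|g| ^+ 2 + 2 * dotp g (G' - G) + V) /\
  F - fs - b * gamma * `|G| ^+ 2 + gamma / 2 * (1 + (1 - p) / p) * `|g - G| ^+ 2
     + b * gamma * (1 + (1 - p) / p) * `|g| ^+ 2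
     - gamma * (1 - s) / 2 * `|G| ^+ 2 = rhs by apply; rewrite rhsE.
rewrite /lhs /rhs; move: (b) (s) (V) => b' s' V'.
by split; field.
Qed.

(** The left side is the conditional expectation of [Psi^(t+1)] given the state [(x, g)]. *)
Lemma lyapunov_step (x g : X) (x' := x - gamma *: g) :
  p * lyapunov f p gamma b (x', grad f x')
  + (1 - p) * (n.+1%:R^-1 * \sum_i
      lyapunov f p gamma b (x', g + grad (f_ i) x' - grad (f_ i) x))
  <= lyapunov f p gamma b (x, g) - gamma * (1 - s) / 2 * `|grad f x| ^+ 2.
Proof.
have [t0 tL] := andP tau_itv.
have fd i y : differentiable (f_ i) y by exact: (f_smooth i).1.
have fs : smooth L f by exact: average_smooth.
have dx : x' - x = - (gamma *: g) by rewrite /x' addrAC subrr add0r.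
have dx2 : `|x' - x| ^+ 2 = gamma ^+ 2 * `|g| ^+ 2.
  by rewrite dx normrN normrZ exprMn gtr0_norm.
under eq_bigr do rewrite -[_ + _ - _]addrA.
apply: lyapunov_step_vec.
- by rewrite /f !grad_average// -scalerBr -sumrB.
- have -> : - (gamma * dotp (grad f x) g) = dotp (grad f x) (x' - x).
    by rewrite dx dotpNr (dotpZr gamma).
  by rewrite -mulrA -dx2; exact: smooth_le.
- have -> : - s * dotp g (grad f x' - grad f x) =
      (L - tau) * dotp (grad f x' - grad f x) (x' - x).
    rewrite dx dotpNr (dotpZr gamma); move: (_ - _) => d.
    by rewrite (dotpC d) /s; ring.
  rewrite -mulrA -dx2.
  exact: (mean_cocoercive f_ L tau x x' L_gt0 t0 f_smooth f_wconv).
Qed.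

End Lyapunov.

(** * Expectations of functions of a finitely valued map *)

Section FiniteValued.
Context {d} {Omega : measurableType d} {R : realType} (P : probability Omega R)
  {T : finType} (h : Omega -> T).
Hypothesis mh : forall s, measurable (h @^-1` [set s]).

Lemma finite_valuedE (phi : T -> R) w :
  phi (h w) = \sum_s phi s * \1_(h @^-1` [set s]) w.
Proof.
rewrite (bigD1 (h w))//= indicE mem_set// mulr1 big1 ?addr0// => s sw.
by rewrite indicE memNset ?mulr0//= => hw; rewrite hw eqxx in sw.
Qed.

Lemma measurable_finite_valued (phi : T -> R) :
  measurable_fun setT (fun w => phi (h w)).
Proof.
under eq_fun do rewrite finite_valuedE.
apply: measurable_sum => s; exact: measurable_funM.
Qed.

Lemma integral_finite_valued (phi wt : T -> R) : (forall s, 0 <= phi s) ->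
  (forall s, P (h @^-1` [set s]) = (wt s)%:E) ->
  (\int[P]_w (phi (h w))%:E = (\sum_s wt s * phi s)%:E)%E.
Proof.
move=> phi0 Ph.
under eq_integral do rewrite finite_valuedE -sumEFin.
rewrite ge0_integral_sum//; last 2 first.
- by move=> s; apply/measurable_EFinP; exact: measurable_funM.
- by move=> s w _; rewrite lee_fin mulr_ge0.
rewrite -sumEFin; apply: eq_bigr => s _.
under eq_integral do rewrite EFinM.
rewrite ge0_integralZl//; last 2 first.
- exact/measurable_EFinP.
- by rewrite lee_fin.
rewrite integral_indic// setIT mulrC EFinM; congr (_ * _)%E.
exact: Ph.
Qed.

End FiniteValued.

(** * Finite histories of draws and their law *)

Section History.
Context {d} {Omega : measurableType d} {R : realType} {P : probability Omega R}
  {n : nat} (p : R).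
Variables (theta : nat -> {RV P >-> bool}) (idx : nat -> {RV P >-> 'I_n.+1}).
Hypotheses (theta_law : forall t, P (theta t @^-1` [set true]) = p%:E)
  (idx_law : forall t, uniform_ord (idx t))
  (indep : mutually_independent P (page_sigma theta idx)).

Definition draw : finType := (bool * 'I_n.+1)%type.

(** The latest draw is outermost, so recursion on a history follows the iteration of PAGE and a sum
    over histories splits off the last draw. *)
Fixpoint history (t : nat) : finType :=
  if t is s.+1 then (draw * history s)%type else unit.

Fixpoint draws (t : nat) (w : Omega) : history t :=
  if t is s.+1 return history t
  then ((theta s w, idx s w), draws s w) else tt.

Definition draw_weight (a : draw) : R := (if a.1 then p else 1 - p) * n.+1%:R^-1.

Fixpoint weight (t : nat) : history t -> R :=
  if t is s.+1 return history t -> R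
  then fun h => draw_weight h.1 * weight s h.2 else fun=> 1.

(** Draw number [j]; the default is returned only for [j >= t]. *)
Fixpoint coord_at (t : nat) : history t -> nat -> draw :=
  if t is s.+1 return history t -> nat -> draw
  then fun h j => if j == s then h.1 else coord_at s h.2 j
  else fun _ _ => (true, ord0).

Lemma weightE t (h : history t) :
  weight t h = \prod_(j <- iota 0 t) draw_weight (coord_at t h j).
Proof.
elim: t h => [|t IH] h; first by rewrite big_nil.
have -> : iota 0 t.+1 = iota 0 t ++ [:: t] by rewrite -addn1 iotaD.
rewrite big_cat/= big_seq1 eqxx mulrC IH; congr (_ * _).
rewrite !big_seq; apply: eq_bigr => j; rewrite mem_iota add0n => /andP[_ jt].
by rewrite ltn_eqF.
Qed.

Lemma draws_fiber t (h : history t) :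
  draws t @^-1` [set h] = [set w | forall j, (j < t)%N ->
    theta j w = (coord_at t h j).1 /\ idx j w = (coord_at t h j).2].
Proof.
elim: t h => [[]|t IH [[a i] h]]; first by apply/seteqP; split.
apply/seteqP; split => w /=.
  move=> [thE iE hE] j; rewrite ltnS leq_eqVlt.
  case: eqP => [->//|_ /= jt].
  have : (draws t @^-1` [set h]) w by [].
  by rewrite IH => /(_ _ jt).
move=> H; have [-> ->] := H t (ltnSn t); rewrite eqxx/=; congr (_, _).
have : (draws t @^-1` [set h]) w.
  rewrite IH => j jt; have := H j (leqW jt).
  by rewrite ltn_eqF.
by [].
Qed.

Lemma sigma_preimage {d'} {T' : measurableType d'} (Y : Omega -> T') (A : set T') :
  measurable A -> g_sigma_algebra_preimage Y (Y @^-1` A).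
Proof. by move=> mA; exists A => //; rewrite setTI. Qed.

(** The fiber is an intersection of [2 t] events, one for each coin and each index, so mutual
    independence factors its probability. *)
Lemma draws_law t (h : history t) : P (draws t @^-1` [set h]) = (weight t h)%:E.
Proof.
pose A (k : nat + nat) : set Omega := match k with
  | inl j => theta j @^-1` [set (coord_at t h j).1]
  | inr j => idx j @^-1` [set (coord_at t h j).2] end.
pose J : seq (nat + nat) := map inl (iota 0 t) ++ map inr (iota 0 t).
have -> : draws t @^-1` [set h] = \bigcap_(k in [set` J]) A k.
  rewrite draws_fiber; apply/seteqP; split => w /=.
    move=> H k /=; rewrite mem_cat => /orP[] /mapP[j];
      by rewrite mem_iota add0n => /andP[_ jt] ->; have [] := H j jt.
  move=> H j jt; split.
    by apply: (H (inl j)); rewrite /= mem_cat map_f// mem_iota.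
  by apply: (H (inr j)); rewrite /= mem_cat orbC map_f// mem_iota.
rewrite indep; last 2 first.
- rewrite cat_uniq !map_inj_uniq ?iota_uniq/= ?andbT; [|by move=> ? ? []..].
  by apply/hasPn => k /mapP[j _ ->]; apply/negP => /mapP[].
- by move=> [j|j] _; exact: sigma_preimage.
rewrite big_cat/= !big_map -big_split/= weightE -prodEFin.
apply: eq_bigr => j _; rewrite /draw_weight EFinM idx_law; congr (_ * _)%E.
case: (coord_at t h j).1 => //.
(* The coin's law is given at [true]; the value [false] is handled by complement. *)
rewrite (_ : _ @^-1` _ = ~` (theta j @^-1` [set true])).
  rewrite probability_setC ?theta_law// -[X in measurable X]setTI.
  exact: measurable_funP.
by apply/seteqP; split => w /=; case: (theta j w).
Qed.

Lemma draws_preimageS t (h : history t.+1) : draws t.+1 @^-1` [set h] =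
  (theta t @^-1` [set h.1.1] `&` idx t @^-1` [set h.1.2])
    `&` draws t @^-1` [set h.2].
Proof.
case: h => -[a i] h; apply/seteqP; split => w /= [].
  by move=> -> -> ->.
by move=> [-> ->] ->.
Qed.

(** Places the histories in the sigma-algebra from which the random time is independent. *)
Lemma sigma_draws t (h : history t) :
  <<s \bigcup_k page_sigma theta idx k >> (draws t @^-1` [set h]).
Proof.
set C := \bigcup_k _.
have CI (A B : set Omega) : <<s C >> A -> <<s C >> B -> <<s C >> (A `&` B).
  exact: (@measurableI _ (g_sigma_algebraType C)).
elim: t h => [[]|t IH h].
  rewrite (_ : _ @^-1` _ = setT); last by apply/seteqP; split.
  exact: (@measurableT _ (g_sigma_algebraType C)).
rewrite draws_preimageS; apply: (CI _ _ _ (IH _)); apply: CI.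
  by apply: sub_gen_smallest; exists (inl t) => //; exact: sigma_preimage.
by apply: sub_gen_smallest; exists (inr t) => //; exact: sigma_preimage.
Qed.

Lemma measurable_draws t (h : history t) : measurable (draws t @^-1` [set h]).
Proof.
elim: t h => [[]|t IH h].
  by rewrite (_ : _ @^-1` _ = setT)//; apply/seteqP; split.
rewrite draws_preimageS; apply: measurableI (IH _); apply: measurableI.
  by rewrite -[X in measurable X]setTI; exact: measurable_funP.
by rewrite -[X in measurable X]setTI; exact: measurable_funP.
Qed.

(** Tower property: the last draw is averaged out with the earlier ones fixed. *)
Lemma sum_history t (phi : history t.+1 -> R) :
  \sum_h weight t.+1 h * phi h =
  \sum_h weight t h * \sum_a draw_weight a * phi (a, h).
Proof.
under [RHS]eq_bigr do rewrite mulr_sumr.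
rewrite exchange_big pair_bigA /=; apply: eq_bigr => -[a h] _ /=.
by rewrite mulrA (mulrC (weight t h)).
Qed.

Lemma sum_draw (F : draw -> R) : \sum_a draw_weight a * F a =
  p * (n.+1%:R^-1 * \sum_i F (true, i))
  + (1 - p) * (n.+1%:R^-1 * \sum_i F (false, i)).
Proof.
transitivity (\sum_(c : bool) \sum_(i < n.+1)
    draw_weight (c, i) * F (c, i)).
  by rewrite pair_bigA; apply: eq_bigr => -[].
by rewrite big_bool/= /draw_weight/= -!mulr_sumr !mulrA.
Qed.

Lemma draw_weight_ge0 a : 0 <= p <= 1 -> 0 <= draw_weight a.
Proof.
move=> /andP[p0 p1]; rewrite /draw_weight mulr_ge0 ?invr_ge0//.
by case: ifP; rewrite ?subr_ge0.
Qed.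

Lemma weight_ge0 t (h : history t) : 0 <= p <= 1 -> 0 <= weight t h.
Proof.
by move=> p01; rewrite weightE prodr_ge0// => j _; exact: draw_weight_ge0.
Qed.

Lemma measurable_draws_fun t (phi : history t -> R) :
  measurable_fun setT (fun w => phi (draws t w)).
Proof. exact/measurable_finite_valued/measurable_draws. Qed.

Lemma integral_draws t (phi : history t -> R) : (forall h, 0 <= phi h) ->
  (\int[P]_w (phi (draws t w))%:E = (\sum_h weight t h * phi h)%:E)%E.
Proof.
move=> phi0; apply: integral_finite_valued => //.
  exact: measurable_draws.
exact: draws_law.
Qed.

Lemma integral_random_draws (T : nat) (tT : {RV P >-> 'I_T.+1})
    (phi : forall t, history t -> R) :
  uniform_ord tT ->
  independent_systems P (g_sigma_algebra_preimage tT)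
    <<s \bigcup_k page_sigma theta idx k >> ->
  (forall t h, 0 <= phi t h) ->
  (\int[P]_w (phi (tT w) (draws (tT w) w))%:E =
    (T.+1%:R^-1 * \sum_(k < T.+1) \sum_h weight k h * phi k h)%:E)%E.
Proof.
move=> tT_law tT_indep phi0.
(* The type of [draws (tT w) w] varies with [tT w]. The integrand is therefore split over the values
   [k] of [tT]: [psi k] is supported on [tT = k], and independence gives the law of the pair
   [H k]. *)
pose H (k : 'I_T.+1) w : 'I_T.+1 * history k := (tT w, draws k w).
pose psi (k : 'I_T.+1) (z : 'I_T.+1 * history k) :=
  if z.1 == k then phi k z.2 else 0.
have HE k z : H k @^-1` [set z] = tT @^-1` [set z.1] `&` draws k @^-1` [set z.2].
  case: z => j h; apply/seteqP; split => w /= []; first by move=> -> ->.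
  by move=> jE hE; rewrite /H jE hE.
have mH k z : measurable (H k @^-1` [set z]).
  rewrite HE; apply: measurableI (measurable_draws _ _).
  by rewrite -[X in measurable X]setTI; exact: measurable_funP.
have psi0 k z : 0 <= psi k z by rewrite /psi; case: ifP.
have PH k z : P (H k @^-1` [set z]) = (T.+1%:R^-1 * weight k z.2)%:E.
  rewrite HE tT_indep; last 2 first.
  - exact: sigma_preimage.
  - exact: sigma_draws.
  by rewrite tT_law EFinM draws_law.
have phiE w : phi (tT w) (draws (tT w) w) = \sum_k psi k (H k w).
  rewrite (bigD1 (tT w))//= /psi/= eqxx big1 ?addr0// => k.
  by rewrite eq_sym => /negPf ->.
under eq_integral do rewrite phiE -sumEFin.
rewrite ge0_integral_sum//; last 2 first.
- move=> k; apply/measurable_EFinP.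
  exact: (measurable_finite_valued (H k) (mH k) (psi k)).
- by move=> k w _; rewrite lee_fin.
rewrite mulr_sumr -sumEFin; apply: eq_bigr => k _.
rewrite (integral_finite_valued P (H k) (mH k) (psi k) _ (psi0 k) (PH k)).
congr (_%:E); rewrite mulr_sumr.
transitivity (\sum_(j < T.+1) \sum_(h : history k)
    T.+1%:R^-1 * weight k h * psi k (j, h)).
  by rewrite pair_bigA; apply: eq_bigr => -[].
rewrite (bigD1 k)//= [X in _ + X]big1 ?addr0 => [|j /negPf jk]; last first.
  by apply: big1 => h _; rewrite /psi/= jk mulr0.
by apply: eq_bigr => h _; rewrite /psi/= eqxx mulrA.
Qed.

End History.

(** * Almost sure convergence from summable expectations *)

Lemma nneseries_lty_cvg0 (R : realType) (u : nat -> R) : (forall k, 0 <= u k) ->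
  (\sum_(0 <= k <oo) (u k)%:E < +oo)%E -> u @ \oo --> (0 : R).
Proof.
move=> u0 Slt; set S := (\sum_(0 <= k <oo) (u k)%:E)%E in Slt.
have u0' k : (0 <= (u k)%:E)%E by rewrite lee_fin.
have Sfin : S \is a fin_num.
  by rewrite ge0_fin_numE//; exact: nneseries_ge0.
apply: cvg_series_cvg_0; apply: nondecreasing_is_cvgn.
  by apply/nondecreasing_series => k _ _; exact: u0.
exists (fine S) => _ [N _ <-].
rewrite -lee_fin fineK// /series/= -sumEFin.
exact: nneseries_lim_ge.
Qed.

(** Exchanging sum and integral of nonnegative terms, the series of the [G t] has expectation at
    most [C]; it is finite almost everywhere, and its terms tend to 0 there. *)
Lemma ae_cvg0_summable_integrals {d} {Omega : measurableType d} {R : realType}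
    (P : probability Omega R) (G : nat -> Omega -> R) (e : nat -> R) (C : R) :
  (forall t, measurable_fun setT (G t)) -> (forall t w, 0 <= G t w) ->
  (forall t, \int[P]_w (G t w)%:E = (e t)%:E)%E ->
  (forall T, \sum_(0 <= t < T) e t <= C) ->
  {ae P, forall w, (fun t => G t w) @ \oo --> (0 : R)}.
Proof.
move=> mG G0 intG eC.
pose S w := (\sum_(0 <= t <oo) (G t w)%:E)%E.
have mEG t : measurable_fun setT (fun w => (G t w)%:E).
  exact/measurable_EFinP.
have S0 w : (0 <= S w)%E by apply: nneseries_ge0 => t _ _; rewrite lee_fin.
have e0 t : (0 <= (e t)%:E)%E.
  by rewrite -intG; apply: integral_ge0 => w _; rewrite lee_fin.
have iS : P.-integrable setT S.
  apply/integrableP; split.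
    by apply: ge0_emeasurable_sum => // t w _ _; rewrite lee_fin.
  under eq_integral do rewrite gee0_abs//.
  rewrite integral_nneseries// => [|t w _]; last by rewrite lee_fin.
  apply: (@le_lt_trans _ _ C%:E); last exact: ltry.
  apply: lime_le; first by apply: is_cvg_nneseries => t _ _; rewrite intG.
  apply: nearW => T; under eq_bigr do rewrite intG.
  by rewrite sumEFin lee_fin.
have := integrable_ae measurableT iS.
apply: filterS => w /(_ Logic.I) Sfin.
by apply: nneseries_lty_cvg0 => //; rewrite ltey_eq Sfin.
Qed.

(** * PAGE as a function of its history, and the telescoped bound *)

Section Page.
Context {R : realType} {X : finHilbertType R} {n : nat} (L tau : R)
  (f_ : 'I_n.+1 -> X -> R).
Hypotheses (L_gt0 : 0 < L) (tau_itv : 0 <= tau <= L)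
  (f_smooth : forall i, smooth L (f_ i))
  (f_wconv : forall i, weakly_convex tau (f_ i))
  (f_lb : has_lbound (range (average f_))).
Context (p gamma : R) (x0 g0 : X).
Hypotheses (p_itv : 0 < p <= 1) (gamma_gt0 : 0 < gamma)
  (gammaL : gamma * L <= 1)
  (contract : gamma * (L - tau) < 1)
  (step : L * gamma * (2 - gamma * (L - tau)) <=
    2 * (1 - (1 - p) / p * gamma ^+ 2 * (tau * L))).

Let f := average f_.
Let s := gamma * (L - tau).
Let b := s / (4 - 2 * s).

Definition page_step (z : X * X) (a : draw (n := n)) : X * X :=
  let: (x, g) := z in
  let x' := x - gamma *: g in
  (x', if a.1 then grad (average f_) x'
       else g + grad (f_ a.2) x' - grad (f_ a.2) x).

Fixpoint page_of (t : nat) : history (n := n) t -> X * X :=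
  if t is u.+1 return history (n := n) t -> X * X
  then fun h => page_step (page_of u h.2) h.1 else fun=> (x0, g0).

Lemma page_draws {d} {Omega : measurableType d} (P : probability Omega R)
    (theta : nat -> {RV P >-> bool}) (idx : nat -> {RV P >-> 'I_n.+1}) t w :
  page f_ gamma x0 g0 (theta ^~ w) (idx ^~ w) t =
  page_of t (draws theta idx t w).
Proof. by elim: t => //= t ->. Qed.

(** By [page_draws] and [integral_draws], this is the expectation of [|grad f x^t|^2]. *)
Definition mean_sqr_grad t : R :=
  \sum_(h : history (n := n) t) weight p t h * `|grad f (page_of t h).1| ^+ 2.

Let mean_lyapunov t : R :=
  \sum_(h : history (n := n) t) weight p t h * lyapunov f p gamma b (page_of t h).

Lemma mean_lyapunovS t : mean_lyapunov t.+1 <=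
  mean_lyapunov t - gamma * (1 - s) / 2 * mean_sqr_grad t.
Proof.
have p01 : 0 <= p <= 1 by case/andP: p_itv => /ltW -> ->.
rewrite /mean_lyapunov sum_history /mean_sqr_grad mulr_sumr -sumrB.
apply: ler_sum => h _; rewrite mulrCA -mulrBr.
apply: ler_wpM2l; first exact: weight_ge0.
rewrite sum_draw /=; case: (page_of t h) => x g /=.
have := lyapunov_step L tau f_ L_gt0 tau_itv f_smooth f_wconv p gamma
  p_itv gamma_gt0 contract step x g.
(* In the refresh branch the new state does not depend on the drawn index. *)
by rewrite mean_cst.
Qed.

Lemma sum_mean_sqr_grad T : \sum_(0 <= t < T) mean_sqr_grad t <=
  lyapunov f p gamma b (x0, g0) / (gamma * (1 - s) / 2).
Proof.
have c0 : 0 < gamma * (1 - s) / 2 by rewrite divr_gt0// mulr_gt0// subr_gt0.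
have p01 : 0 <= p <= 1 by case/andP: p_itv => /ltW -> ->.
rewrite ler_pdivlMr//.
have ge0 : 0 <= mean_lyapunov T.
  apply: sumr_ge0 => h _; apply: mulr_ge0; first exact: weight_ge0.
  exact: (lyapunov_ge0 L tau).
(* Telescoping [mean_lyapunovS], then discarding the nonnegative final value. *)
suff : mean_lyapunov T <= lyapunov f p gamma b (x0, g0) -
    (\sum_(0 <= t < T) mean_sqr_grad t) * (gamma * (1 - s) / 2) by move: ge0; lra.
elim: {ge0} T => [|T IH].
  rewrite big_nil mul0r subr0 /mean_lyapunov (bigD1 tt)//= mul1r big1 ?addr0//.
apply: (le_trans (mean_lyapunovS T)).
by rewrite big_nat_recr//= mulrDl (mulrC (mean_sqr_grad T)); move: IH; lra.
Qed.

End Page.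

Theorem theorem2p3 (R : realType) (X : finHilbertType R)
  (n : nat) (L tau : R) (f_ : 'I_n.+1 -> X -> R)
  (L_gt0 : 0 < L) (tau_itv : 0 <= tau <= L)
  (f_smooth : forall i, smooth L (f_ i))
  (f_wconv : forall i, weakly_convex tau (f_ i))
  (f_lb : has_lbound (range (average f_)))
  (p gamma : R) (x0 g0 : X)
  (p_itv : 0 < p <= 1) (gamma_gt0 : 0 < gamma)
  (gamma_le : gamma <=
     1 / (L * (1 + Num.sqrt (2 * tau / (L + tau)) * Num.sqrt ((1 - p) / p))))
  (gamma_lt : tau = 0 -> gamma < 1 / L)
  (d : measure_display) (Omega : measurableType d) (P : probability Omega R)
  (theta : nat -> {RV P >-> bool}) (idx : nat -> {RV P >-> 'I_n.+1})
  (theta_law : forall t, P (theta t @^-1` [set true]) = p%:E)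
  (idx_law : forall t, uniform_ord (idx t))
  (indep : mutually_independent P (page_sigma theta idx)) :
  let f := average f_ in
  let f_star := inf (range f) in
  let a := 1 / 2 in
  let b := gamma * (L - tau) / (4 - 2 * gamma * (L - tau)) in
  let Psi0 := f x0 - f_star - b * gamma * `|grad f x0| ^+ 2
              + a * gamma / p * `|g0 - grad f x0| ^+ 2
              + b * gamma / p * `|g0| ^+ 2 in
  let x t w := (page f_ gamma x0 g0 (theta ^~ w) (idx ^~ w) t).1 in
  (forall (T : nat) (tT : {RV P >-> 'I_T.+1}),
     uniform_ord tT ->
     independent_systems P (g_sigma_algebra_preimage tT)
       <<s \bigcup_k page_sigma theta idx k >> ->
     ('E_P[(fun w => `|grad f (x (tT w) w)| ^+ 2)%R] <=
       (1 / T.+1%:R * (2 * Psi0 / (gamma - gamma ^+ 2 * (L - tau))))%:E)%E) /\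
  {ae P, forall w, (fun t => `|grad f (x t w)| ^+ 2) @ \oo --> (0 : R)}.
Proof.
move=> f f_star a b Psi0 x.
have gammaL := stepsize_le1 L tau p gamma L_gt0 gamma_le.
have contract := stepsize_contract L tau p gamma L_gt0 tau_itv gamma_gt0
  gamma_le gamma_lt.
have step := stepsize_bound L tau p gamma L_gt0 tau_itv p_itv gamma_gt0 gamma_le.
pose phi t (h : history t) := `|grad f (page_of f_ gamma x0 g0 t h).1| ^+ 2.
have phi0 t h : 0 <= phi t h by exact: sqr_ge0.
have xE t w : `|grad f (x t w)| ^+ 2 = phi t (draws theta idx t w).
  by rewrite /x page_draws.
have bound := sum_mean_sqr_grad L tau f_ L_gt0 tau_itv f_smooth f_wconv f_lb
  p gamma x0 g0 p_itv gamma_gt0 gammaL contract step.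
have boundE : lyapunov f p gamma
      (gamma * (L - tau) / (4 - 2 * (gamma * (L - tau)))) (x0, g0) /
      (gamma * (1 - gamma * (L - tau)) / 2) =
    2 * Psi0 / (gamma - gamma ^+ 2 * (L - tau)).
  rewrite (mulrA 2 gamma) invf_div (mulrCA _ 2) (mulrA 2 (lyapunov _ _ _ _ _)).
  by congr (_ / _); rewrite mulrBr mulr1 mulrA -expr2.
rewrite -/f boundE in bound.
split=> [T tT tT_law tT_indep|].
  rewrite unlock; under eq_integral do rewrite xE.
  rewrite (integral_random_draws p theta idx theta_law idx_law indep T tT phi)//.
  rewrite lee_fin mul1r ler_wpM2l ?invr_ge0//.
  (* The times [0, ..., T] make [T.+1] terms. *)
  by have := bound T.+1; rewrite big_mkord.
apply: (ae_cvg0_summable_integrals P (fun t w => `|grad f (x t w)| ^+ 2)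
  _ _ _ _ _ bound) => [t|t w|t].
- under eq_fun do rewrite xE.
  exact: (measurable_draws_fun theta idx t).
- exact: sqr_ge0.
- under eq_integral do rewrite xE.
  exact: (integral_draws p theta idx theta_law idx_law indep t (phi t)).
Qed.
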